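(* Let $\mathfrak g$ be a hyperbolic Kac–Moody algebra over $\mathbb C$ of rank $\ell$, $\mathfrak k$ its compact real form and $\mathfrak g_{\mathbb R}$ its split real form. Let $\mathfrak h,\mathfrak h_{\mathbb R},\mathfrak t$ be the standard Cartan subalgebras of $\mathfrak g,\mathfrak g_{\mathbb R},\mathfrak k$ respectively, each of the latter two equipped with the restriction of the invariant form $(\cdot,\cdot)$ of $\mathfrak g$. Then $\mathfrak h_{\mathbb R}\cong\mathbb R^{\ell-1,1}$ has signature $(\ell-1,1)$, and $\mathfrak t=\mathbf i\,\mathfrak h_{\mathbb R}=\{\mathbf i x: x\in\mathfrak h_{\mathbb R}\}$, where $\mathbf i^2=-1$. The signature of $\mathfrak t\cong\mathbb R^{1,\ell-1}$ is $(1,\ell-1)$.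
   Context: $\mathfrak g=\mathfrak g_{\mathbb C}(A)$ for an indecomposable symmetrizable generalized Cartan matrix $A=(a_{ij})_{1\le i,j\le\ell}$ of hyperbolic type: $A$ is of neither finite nor affine type, but every proper indecomposable principal submatrix is of finite or affine type. $\mathfrak g$ has Chevalley generators $e_i,f_i,h_i$, $\mathfrak h=\bigoplus_i\mathbb Ch_i$ is its standard Cartan subalgebra (of dimension $\ell$) and $\alpha_i(h_j)=a_{ij}$. $\mathfrak g_{\mathbb R}=\mathfrak g_{\mathbb R}(A)$ is the real Kac–Moody algebra generated by the same generators, and $\mathfrak h_{\mathbb R}=\mathfrak h\cap\mathfrak g_{\mathbb R}=\bigoplus_i\mathbb Rh_i$. $\omega$ is the conjugate-linear involution of $\mathfrak g$ with $\omega(e_i)=-f_i$, $\omega(f_i)=-e_i$, $\omega(h_i)=-h_i$; $\mathfrak k=\{x\in\mathfrak g:\omega(x)=x\}$ and $\mathfrak t=\mathfrak h\cap\mathfrak k$. $(\cdot,\cdot)$ is the nondegenerate invariant symmetric bilinear form on $\mathfrak g$, unique up to scaling and scaled so that $(h_i,h_i)>0$ for all $i$. Signature $(p,q)$ means $p$ positive and $q$ negative directions. *)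

(* Defs.v *)
From HB Require Import structures.
From mathcomp Require Import all_boot all_order all_algebra.
From mathcomp Require Import sesquilinear complex.
From mathcomp Require Import classical_sets reals.

Set Implicit Arguments.
Unset Strict Implicit.
Unset Printing Implicit Defensive.

Import Order.TTheory GRing.Theory Num.Theory.
Local Open Scope classical_set_scope.
Local Open Scope ring_scope.

HB.mixin Record Lmodule_isLie (K : fieldType) L of GRing.Lmodule K L := {
  lie : L -> L -> L;
  lie_linearl : forall y, linear (lie^~ y);
  lie_linearr : forall x, linear (lie x);
  liexx : forall x, lie x x = 0;
  jacobi : forall x y z,
    lie x (lie y z) + lie y (lie z x) + lie z (lie x y) = 0
}.

#[short(type="lieAlgType")]
HB.structure Definition LieAlgebra (K : fieldType) :=
  {L of GRing.Lmodule K L & Lmodule_isLie K L}.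

Definition lie_morphism (K : fieldType) (L L' : lieAlgType K) (phi : L -> L') :=
  forall x y, phi (lie x y) = lie (phi x) (phi y).

Definition gen_cartan_matrix n (A : 'M[int]_n) : Prop :=
  [/\ forall i, A i i = 2,
      forall i j, i != j -> A i j <= 0 &
      forall i j, A i j = 0 -> A j i = 0].

Definition indecomposable n (A : 'M[int]_n) : Prop :=
  forall S : {set 'I_n}, S != finset.set0 -> S != [set: 'I_n]%SET ->
    exists i j, [/\ i \in S, j \notin S & (A i j != 0) || (A j i != 0)].

Definition symmetrizable n (A : 'M[int]_n) : Prop :=
  exists (d : 'rV[rat]_n) (B : 'M[rat]_n),
    [/\ forall i, d 0 i != 0, B^T = B & map_mx intr A = diag_mx d *m B].

Definition principal_submx n (A : 'M[int]_n) (S : {set 'I_n}) : 'M[int]_#|S| :=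
  mxsub (@enum_val _ (mem S)) (@enum_val _ (mem S)) A.

(* Finite and affine type as in Vinberg's trichotomy
   (Kac, Infinite dimensional Lie algebras, Theorem 4.3);
   only meant for indecomposable matrices. *)
Section Types.
Variables (R : realType) (n : nat).

Definition pos_vec (v : 'cV[R]_n) : Prop := forall i, 0 < v i 0.
Definition nneg_vec (v : 'cV[R]_n) : Prop := forall i, 0 <= v i 0.

Definition finite_type (A : 'M[int]_n) : Prop :=
  let M : 'M[R]_n := map_mx intr A in
  [/\ \det M != 0,
      exists u, pos_vec u /\ pos_vec (M *m u) &
      forall v, nneg_vec (M *m v) -> pos_vec v \/ v = 0].

Definition affine_type (A : 'M[int]_n) : Prop :=
  let M : 'M[R]_n := map_mx intr A in
  [/\ (\rank M).+1 = n,
      exists u, pos_vec u /\ M *m u = 0 &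
      forall v, nneg_vec (M *m v) -> M *m v = 0].

End Types.

Definition hyperbolic_type (R : realType) n (A : 'M[int]_n) : Prop :=
  [/\ ~ finite_type R A,
      ~ affine_type R A &
      forall S : {set 'I_n}, S \proper [set: 'I_n]%SET ->
        indecomposable (principal_submx A S) ->
        finite_type R (principal_submx A S) \/
        affine_type R (principal_submx A S)].

Section KacMoody.
Variables (K : fieldType) (n : nat) (A : 'M[int]_n).

(* The convention is alpha_i(h_j) = A i j, so that alpha_j(h_i) = A j i
   is the entry in the Serre relation for (ad e_i) acting on e_j. *)
Record chevalley_serre (L : lieAlgType K) (e f h : 'I_n -> L) : Prop := {
  cs_hh : forall i j, lie (h i) (h j) = 0;
  cs_he : forall i j, lie (h j) (e i) = (A i j)%:~R *: e i;
  cs_hf : forall i j, lie (h j) (f i) = - ((A i j)%:~R *: f i);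
  cs_ef : forall i j, lie (e i) (f j) = if i == j then h i else 0;
  cs_ee : forall i j, i != j -> iter `|1 - A j i|%N (lie (e i)) (e j) = 0;
  cs_ff : forall i j, i != j -> iter `|1 - A j i|%N (lie (f i)) (f j) = 0
}.

Definition generators_map (L L' : lieAlgType K)
    (e f h : 'I_n -> L) (e' f' h' : 'I_n -> L') (phi : L -> L') : Prop :=
  forall i, [/\ phi (e i) = e' i, phi (f i) = f' i & phi (h i) = h' i].

(* L is the Lie algebra presented by the generators e_i, f_i, h_i and the
   relations above. For symmetrizable A this is the Kac-Moody algebra
   (Gabber-Kac), without extra derivations; none are needed when
   det A != 0, in particular for hyperbolic A. *)
Definition kac_moody_algebra (L : lieAlgType K) (e f h : 'I_n -> L) : Prop :=
  chevalley_serre e f h /\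
  forall (L' : lieAlgType K) (e' f' h' : 'I_n -> L'),
    chevalley_serre e' f' h' ->
    exists phi : {linear L -> L'},
      [/\ lie_morphism phi, generators_map e f h e' f' h' phi &
          forall psi : {linear L -> L'}, lie_morphism psi ->
            generators_map e f h e' f' h' psi -> psi =1 phi].

End KacMoody.

Section RealForms.
Variables (R : realType) (g : lieAlgType R[i]).
Local Notation C := R[i].
Local Notation "r %:C" := (real_complex R r).

Record real_lie_subalgebra (S : set g) : Prop := {
  rls_0 : S 0;
  rls_add : forall x y, S x -> S y -> S (x + y);
  rls_scale : forall (r : R) x, S x -> S (r%:C *: x);
  rls_lie : forall x y, S x -> S y -> S (lie x y)
}.

Section Generators.
Variables (n : nat) (e f h : 'I_n -> g).

Definition cartan : set g := [set \sum_i c i *: h i | c in [set: 'I_n -> C]].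

Definition split_form : set g :=
  smallest real_lie_subalgebra (range e `|` range f `|` range h).

Definition split_cartan : set g := cartan `&` split_form.

Record compact_involution (omega : g -> g) : Prop := {
  ci_conj_linear : linear_for (Num.conj \; *:%R) omega;
  ci_lie : lie_morphism omega;
  ci_involutive : involutive omega;
  ci_e : forall i, omega (e i) = - f i;
  ci_f : forall i, omega (f i) = - e i;
  ci_h : forall i, omega (h i) = - h i
}.

Definition compact_form (omega : g -> g) : set g := [set x | omega x = x].

Definition compact_cartan (omega : g -> g) : set g :=
  cartan `&` compact_form omega.

(* In R[i], 0 < z means that z is real and positive. *)
Record normalized_invariant_form (B : {symmetric g}) : Prop := {
  nif_invariant : forall x y z, B (lie x y) z = B x (lie y z);
  nif_nondegenerate : forall x, (forall y, B x y = 0) -> x = 0;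
  nif_normalized : forall i, 0 < B (h i) (h i)
}.

End Generators.

Definition real_basis m (v : 'I_m -> g) (V : set g) : Prop :=
  (forall c : 'I_m -> R, \sum_i (c i)%:C *: v i = 0 -> forall i, c i = 0) /\
  V = [set \sum_i (c i)%:C *: v i | c in [set: 'I_m -> R]].

(* As 0 < z and z < 0 force z to be real, the form is automatically
   real-valued on V. *)
Definition has_signature (B : {symmetric g}) (V : set g) (p q : nat) : Prop :=
  exists v : 'I_(p + q) -> g,
    [/\ real_basis v V,
        forall i j, i != j -> B (v i) (v j) = 0,
        forall i : 'I_p, 0 < B (v (lshift q i)) (v (lshift q i)) &
        forall j : 'I_q, B (v (rshift p j)) (v (rshift p j)) < 0].

Definition pseudo_euclidean p q (x y : 'rV[R]_(p + q)) : R :=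
  \sum_(i < p) x 0 (lshift q i) * y 0 (lshift q i)
  - \sum_(j < q) x 0 (rshift p j) * y 0 (rshift p j).

Definition isometric_to_Rpq (B : {symmetric g}) (V : set g) (p q : nat) : Prop :=
  exists phi : 'rV[R]_(p + q) -> g,
    [/\ forall (a : R) x y, phi (a *: x + y) = a%:C *: phi x + phi y,
        injective phi,
        range phi = V &
        forall x y, B (phi x) (phi y) = (pseudo_euclidean x y)%:C].

End RealForms.

(* Main.v *)
(* Invariance gives (h_i, h_j) = eps_i a_ij with eps_i = (e_i, f_i), and
   2 eps_i = (h_i, h_i) > 0; so the Gram matrix G of the coroots is a real
   symmetric matrix with nonpositive off-diagonal entries.

   Signature of G: every proper principal submatrix splits into blocks of finite
   or affine type, each with a vector u > 0 such that G u >= 0, which forces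
   positive semidefiniteness; so G is positive semidefinite on each coordinate
   hyperplane.  If G were positive semidefinite, A would be of finite or affine
   type; so there is x with q(x) < 0.  A kernel vector could be used to move x
   into a coordinate hyperplane without changing q(x), so G is nondegenerate; a
   negative vector orthogonal to x would span with x a negative definite plane
   meeting a coordinate hyperplane, so q is positive on the complement of x.

   Real forms: the universal property provides the linear Chevalley involution
   of g; composed with omega it is a conjugation fixing the split form pointwise,
   so an element of h in the split form has real coordinates. *)
Require Import Defs.
From HB Require Import structures.
From mathcomp Require Import all_boot all_order all_algebra.
From mathcomp Require Import sesquilinear complex.
From mathcomp Require Import boolp classical_sets reals.
From mathcomp Require Import ring lra zify.

Set Implicit Arguments.
Unset Strict Implicit.
Unset Printing Implicit Defensive.

Import Order.TTheory GRing.Theory Num.Theory.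
Local Open Scope classical_set_scope.
Local Open Scope ring_scope.

(** * Quadratic forms with nonpositive off-diagonal entries *)

Section QuadraticForms.
Variable F : realFieldType.

Definition bform n (G : 'M[F]_n) (x y : 'rV[F]_n) : F := (x *m G *m y^T) 0 0.

Definition psd n (G : 'M[F]_n) : Prop := forall x, 0 <= bform G x x.

Definition offdiag_npos n (G : 'M[F]_n) : Prop :=
  forall i j, i != j -> G i j <= 0.

Definition irreducible_mx n (G : 'M[F]_n) : Prop :=
  forall S : {set 'I_n}, S != finset.set0 -> S != [set: 'I_n]%SET ->
    exists i j, [/\ i \in S, j \notin S & G i j != 0].

Section Bform.
Variables (n : nat) (G : 'M[F]_n).
Implicit Types x y z : 'rV[F]_n.

Lemma bformEr x y : bform G x y = \sum_j (x *m G) 0 j * y 0 j.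
Proof. by rewrite /bform [LHS]mxE; apply: eq_bigr => j _; rewrite [y^T _ _]mxE. Qed.

Lemma bformE x y : bform G x y = \sum_i \sum_j G i j * x 0 i * y 0 j.
Proof.
rewrite bformEr exchange_big /=; apply: eq_bigr => j _.
by rewrite mxE mulr_suml; apply: eq_bigr => i _; rewrite [x 0 i * _]mulrC.
Qed.

Lemma bformDl x y z : bform G (x + y) z = bform G x z + bform G y z.
Proof. by rewrite /bform !mulmxDl mxE. Qed.

Lemma bformDr x y z : bform G z (x + y) = bform G z x + bform G z y.
Proof. by rewrite /bform linearD /= mulmxDr mxE. Qed.

Lemma bformZl a x y : bform G (a *: x) y = a * bform G x y.
Proof. by rewrite /bform -!scalemxAl mxE. Qed.

Lemma bformZr a x y : bform G x (a *: y) = a * bform G x y.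
Proof. by rewrite /bform linearZ /= -scalemxAr mxE. Qed.

Lemma bformC x y : G^T = G -> bform G x y = bform G y x.
Proof.
move=> Gs; rewrite /bform -[RHS](mxE trmx_key (fun i j => (y *m G *m x^T) j i)).
by rewrite -/(trmx _) !trmx_mul trmxK Gs mulmxA.
Qed.

Lemma bform_ker x y : x *m G = 0 -> bform G x y = 0.
Proof. by rewrite /bform => ->; rewrite mul0mx mxE. Qed.

(** Along [y + t *: x] the form is affine in [t] with slope twice [bform G x y], so nonnegativity
    forces this slope to vanish for every [y]. *)
Lemma psd_isotropic x : G^T = G -> psd G -> bform G x x = 0 -> x *m G = 0.
Proof.
move=> Gs Gp x0.
have xy0 y : bform G x y = 0.
  apply/eqP/negPn/negP => b0.
  set b := bform G x y in b0; set q := bform G y y.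
  (* The coefficient [t] of [x] solves [q + 2 * t * b = -1]. *)
  have := Gp (y + (- (q + 1) / (2 * b)) *: x).
  rewrite !(bformDl, bformDr, bformZl, bformZr) x0 [bform G y x]bformC //.
  rewrite -/b -/q.
  suff -> : q + - (q + 1) / (2 * b) * b +
    (- (q + 1) / (2 * b) * b + - (q + 1) / (2 * b) * (- (q + 1) / (2 * b) * 0))
    = -1 by lra.
  by field; rewrite b0.
apply/rowP => j; have := xy0 (delta_mx 0 j).
rewrite bformEr (bigD1 j) //= big1 => [|k kj]; last first.
  by rewrite [delta_mx _ _ _ _]mxE (negbTE kj) andbF mulr0.
by rewrite [delta_mx _ _ _ _]mxE !eqxx mulr1 addr0 => ->; rewrite mxE.
Qed.

(** Diagonal terms are unchanged; off the diagonal a nonpositive coefficient multiplies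
    [|x i * x j| >= x i * x j]. *)
Lemma bform_abs x : offdiag_npos G ->
  bform G (map_mx Num.norm x) (map_mx Num.norm x) <= bform G x x.
Proof.
move=> Gz; rewrite !bformE; apply: ler_sum => i _; apply: ler_sum => j _.
rewrite !mxE -!mulrA; have [->|ij] := eqVneq i j.
  by rewrite -normrM ger0_norm // -expr2 sqr_ge0.
by rewrite ler_wnM2l ?Gz // -normrM ler_norm.
Qed.

(** A minimum principle: for nonzero [x], irreducibility links a zero index [i] to some [j] with
    [x 0 j > 0], and no other term of [(x *m G) 0 i] can compensate [x 0 j * G j i < 0]. *)
Lemma superharmonic_zero x i0 : G^T = G -> offdiag_npos G ->
    irreducible_mx G -> (forall i, 0 <= x 0 i) ->
    (forall i, 0 <= (x *m G) 0 i) -> x 0 i0 = 0 -> x = 0.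
Proof.
move=> Gs Gz Gi x0 xG xi0.
pose S := finset (fun i => x 0 i == 0).
have [ST|ST] := eqVneq S [set: 'I_n]%SET.
  apply/rowP => i; have : i \in S by rewrite ST inE.
  by rewrite inE mxE => /eqP.
have S0 : S != finset.set0.
  by apply/set0Pn; exists i0; rewrite inE xi0.
have [i [j [iS jS Gij]]] := Gi _ S0 ST.
move: iS jS; rewrite !inE => /eqP xi xj.
have ij : j != i by apply: contraNneq xj => ->; rewrite xi.
have Gji : G j i = G i j by rewrite -[in RHS]Gs mxE.
have : (x *m G) 0 i < 0.
  rewrite mxE (bigD1 j) //= ltr_wnDr //.
    apply: sumr_le0 => k _; have [->|ki] := eqVneq k i; first by rewrite xi mul0r.
    by rewrite mulr_ge0_le0 // Gz.
  rewrite pmulr_rlt0; last by rewrite lt_def xj x0.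
  by rewrite lt_def eq_sym Gz // andbT Gji.
by rewrite ltNge xG.
Qed.

End Bform.

(* With [x i = u i * y i], replace [y i * y j] by [(y i ^+ 2 + y j ^+ 2) / 2]:
   the form only decreases since the off-diagonal entries are nonpositive. *)
Lemma superharmonic_psd n (G : 'M[F]_n) (u : 'rV[F]_n) :
    G^T = G -> offdiag_npos G -> (forall i, 0 < u 0 i) ->
    (forall i, 0 <= (u *m G) 0 i) -> psd G.
Proof.
move=> Gs Gz u0 uG x; rewrite bformE.
pose y i := x 0 i / u 0 i.
have xE i : x 0 i = u 0 i * y i by rewrite mulrC divfK // gt_eqF.
have uGE : 0 <=
    \sum_i \sum_j G i j * u 0 i * u 0 j * (y i ^+ 2).
  apply: sumr_ge0 => i _; rewrite -mulr_suml mulr_ge0 ?sqr_ge0 //.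
  suff -> : \sum_j G i j * u 0 i * u 0 j = u 0 i * (u *m G) 0 i.
    by rewrite mulr_ge0 // ltW.
  rewrite mxE mulr_sumr; apply: eq_bigr => j _.
  by rewrite -[in LHS]Gs mxE; ring.
have half : \sum_i \sum_j G i j * u 0 i * u 0 j * ((y i ^+ 2 + y j ^+ 2) / 2)
    = \sum_i \sum_j G i j * u 0 i * u 0 j * (y i ^+ 2).
  have sw : \sum_i \sum_j G i j * u 0 i * u 0 j * (y j ^+ 2)
    = \sum_i \sum_j G i j * u 0 i * u 0 j * (y i ^+ 2).
    rewrite exchange_big /=; apply: eq_bigr => i _; apply: eq_bigr => j _.
    by rewrite -[in LHS]Gs mxE; ring.
  transitivity ((\sum_i \sum_j G i j * u 0 i * u 0 j * (y i ^+ 2)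
    + \sum_i \sum_j G i j * u 0 i * u 0 j * (y j ^+ 2)) / 2); last first.
    by rewrite sw; field.
  rewrite -big_split mulr_suml /=; apply: eq_bigr => i _.
  rewrite -big_split mulr_suml /=; apply: eq_bigr => j _.
  by rewrite mulrDl mulrDr !mulrA -mulrDl.
apply: le_trans uGE _; rewrite -half; apply: ler_sum => i _.
apply: ler_sum => j _; rewrite !xE.
have -> : G i j * (u 0 i * y i) * (u 0 j * y j) =
  G i j * u 0 i * u 0 j * (y i * y j) by ring.
have [->|ij] := eqVneq i j; first by rewrite -expr2 mulrDl -splitr.
rewrite ler_wnM2l //; last first.
  rewrite ler_pdivlMr ?ltr0n // -subr_ge0.
  suff -> : y i ^+ 2 + y j ^+ 2 - y i * y j * 2 = (y i - y j) ^+ 2.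
    exact: sqr_ge0.
  by ring.
by rewrite !mulr_le0_ge0 ?Gz ?ltW.
Qed.

End QuadraticForms.

(** * Finite, affine and hyperbolic type *)

Section VinbergTypes.
Variable R : realType.

Definition scaled_mx n (eps : 'I_n -> R) (A : 'M[int]_n) : 'M[R]_n :=
  \matrix_(i, j) (eps i * (A i j)%:~R).

(** * Positive semidefinite symmetrized Cartan matrices *)

Section Scaled.
Variables (n : nat) (A : 'M[int]_n) (eps : 'I_n -> R).
Hypothesis eps_gt0 : forall i, 0 < eps i.
Hypothesis A_gcm : gen_cartan_matrix A.
Let M : 'M[R]_n := map_mx intr A.
Let G := scaled_mx eps A.
Hypothesis G_sym : G^T = G.

Lemma scaled_mxE : G = diag_mx (\row_i eps i) *m M.
Proof. by apply/matrixP => i j; rewrite mul_diag_mx !mxE. Qed.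

Lemma diag_eps_unit : diag_mx (\row_i eps i) \in unitmx.
Proof.
rewrite unitmxE det_diag unitfE; apply/prodf_neq0 => i _.
by rewrite mxE gt_eqF.
Qed.

(** The types let [M] act on columns, the form lets [G] act on rows; as [eps i > 0], this identity
    carries sign conditions from one to the other. *)
Lemma mul_scaled_mx (u : 'cV[R]_n) i : (u^T *m G) 0 i = eps i * (M *m u) i 0.
Proof.
rewrite -G_sym -trmx_mul [LHS]mxE scaled_mxE -mulmxA mul_diag_mx [LHS]mxE.
by rewrite [(\row_j _) _ _]mxE.
Qed.

Lemma scaled_offdiag : offdiag_npos G.
Proof.
move=> i j ij; rewrite mxE pmulr_rle0 // lerz0.
by case: A_gcm => _ + _; exact.
Qed.

Lemma scaled_irreducible : indecomposable A -> irreducible_mx G.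
Proof.
move=> Ai S S0 ST; have [i [j [iS jS Aij]]] := Ai S S0 ST.
have nz a b : A a b != 0 -> G a b != 0.
  by move=> ab; rewrite mxE mulf_neq0 ?intr_eq0 // gt_eqF.
exists i, j; split=> //; case/orP: Aij => /nz // ji.
by rewrite -G_sym mxE.
Qed.

Hypothesis A_indec : indecomposable A.
Hypothesis G_psd : psd G.

Let zeroP (x : 'rV[R]_n) i : (forall j, 0 <= x 0 j) -> (forall j, 0 <= (x *m G) 0 j) ->
  x 0 i = 0 -> x = 0.
Proof.
exact: (superharmonic_zero G_sym scaled_offdiag (scaled_irreducible A_indec)).
Qed.

(* Pairing [x *m G] with the negative part of [x]. *)
Lemma pd_superharmonic (x : 'rV[R]_n) : G \in unitmx ->
  (forall j, 0 <= (x *m G) 0 j) -> (forall j, 0 < x 0 j) \/ x = 0.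
Proof.
move=> Gu xG.
pose m := \row_i Num.max 0 (- x 0 i); pose p := \row_i Num.max 0 (x 0 i).
have xpm : x = p + (- 1) *: m.
  apply/rowP => i; rewrite !mxE mulN1r.
  have [x0|x0] := leP 0 (x 0 i); first by rewrite max_l ?oppr_le0 // subr0.
  by rewrite max_r ?sub0r ?opprK // oppr_ge0 ltW.
have pm0 : bform G p m <= 0.
  rewrite bformE; apply: sumr_le0 => i _; apply: sumr_le0 => j _.
  have [<-|ij] := eqVneq i j.
    rewrite -mulrA !mxE; have [x0|x0] := leP 0 (x 0 i).
      by rewrite [Num.max _ (- _)]max_l ?oppr_le0 // !mulr0.
    by rewrite mul0r mulr0.
  rewrite -mulrA mulr_le0_ge0 ?scaled_offdiag // !mxE.
  by rewrite mulr_ge0 // le_max lexx.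
have xm0 : 0 <= bform G x m.
  rewrite bformEr; apply: sumr_ge0 => j _; rewrite mulr_ge0 //.
  by rewrite mxE le_max lexx.
(* Since [0 <= bform G x m = bform G p m - bform G m m] and [bform G p m <= 0], [m] is isotropic,
   hence in the trivial kernel of [G]. *)
have m0 : m = 0.
  apply: (can_inj (mulmxK Gu)); rewrite mul0mx; apply: psd_isotropic => //.
  apply/eqP; rewrite eq_le G_psd andbT.
  move: xm0; rewrite xpm bformDl bformZl; lra.
have x0 j : 0 <= x 0 j.
  by rewrite xpm m0 scaler0 addr0 mxE le_max lexx.
have [|b] := pselect (forall j, 0 < x 0 j); first by left.
right; move: b => /existsNP[j /negP]; rewrite -leNgt => xj.
by apply: (@zeroP _ j) => //; apply/eqP; rewrite eq_le xj x0.
Qed.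

Lemma psd_unit_finite : G \in unitmx -> finite_type R A.
Proof.
move=> Gu; split.
- apply: contraTneq Gu => M0.
  by rewrite scaled_mxE unitmxE det_mulmx M0 mulr0 unitr0.
(* A solution of [x *m G = const_mx 1] cannot be zero, so [pd_superharmonic] makes it strictly
   positive. *)
- pose x : 'rV[R]_n := const_mx 1 *m invmx G.
  have xG : x *m G = const_mx 1 by rewrite mulmxKV.
  exists x^T; split=> i.
    rewrite mxE; have [||x0] := @pd_superharmonic x Gu; last 2 first.
    - by apply.
    - move: xG; rewrite x0 mul0mx => /rowP/(_ i); rewrite !mxE => /esym/eqP.
      by rewrite oner_eq0.
    - by move=> j; rewrite xG mxE ler01.
  rewrite -(pmulr_rgt0 _ (eps_gt0 i)) -mul_scaled_mx trmxK xG mxE.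
  exact: ltr01.
- move=> v Mv; have [|vp|v0] := @pd_superharmonic v^T Gu.
  + by move=> j; rewrite mul_scaled_mx mulr_ge0 // ltW.
  + by left=> i; have := vp i; rewrite mxE.
  + by right; apply: trmx_inj; rewrite v0 trmx0.
Qed.

(** A Perron-Frobenius argument: the absolute value of a kernel vector is again in the kernel, and a
    nonnegative kernel vector with a zero coordinate vanishes; so the kernel is a line spanned by a
    positive [u]. *)
Lemma psd_singular_affine : G \notin unitmx -> affine_type R A.
Proof.
rewrite -row_free_unit -kermx_eq0 => /rowV0Pn[w /sub_kermxP wG w0].
pose u := map_mx Num.norm w.
have uG : u *m G = 0.
  apply: psd_isotropic => //; apply/eqP; rewrite eq_le G_psd andbT.
  by rewrite (le_trans (bform_abs _ scaled_offdiag)) // (bform_ker _ wG).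
have ker0 (x : 'rV[R]_n) i : (forall j, 0 <= x 0 j) -> x *m G = 0 -> x 0 i = 0 -> x = 0.
  by move=> x0 xG; apply: zeroP => // j; rewrite xG mxE.
have u_gt0 i : 0 < u 0 i.
  rewrite lt_def mxE normr_ge0 andbT normr_eq0.
  apply: contra_neq w0 => wi; have : u = 0.
    by apply: (@ker0 _ i) => // [j|]; rewrite mxE ?wi ?normr0.
  move=> /rowP ux; apply/rowP => j; have := ux j.
  by rewrite !mxE => /normr0P/eqP.
have [i0 wi0] : exists i, w 0 i != 0.
  apply/existsP; apply: contraNT w0 => /existsPn wn.
  by apply/eqP/rowP => j; rewrite mxE; apply/eqP; have := wn j; rewrite negbK.
(* The multiple of [u] is chosen to make the difference vanish at [i0]; its absolute value is then a
   kernel vector with a zero coordinate. *)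
have M0 (v : 'rV[R]_n) : v *m G = 0 -> (v <= u)%MS.
  move=> vG; apply/sub_rVP; exists (v 0 i0 / u 0 i0).
  pose d := v - (v 0 i0 / u 0 i0) *: u.
  suff : d = 0 by move/eqP; rewrite subr_eq0 => /eqP.
  have dG : d *m G = 0 by rewrite mulmxBl -scalemxAl uG vG scaler0 subr0.
  have di0 : d 0 i0 = 0 by rewrite !mxE divfK ?subrr // normr_eq0.
  have ad0 : map_mx Num.norm d = 0.
    apply: (@ker0 _ i0); last by rewrite mxE di0 normr0.
      by move=> j; rewrite mxE.
    apply: psd_isotropic => //; apply/eqP; rewrite eq_le G_psd andbT.
    by rewrite (le_trans (bform_abs _ scaled_offdiag)) // (bform_ker _ dG).
  apply/rowP => j; move/rowP: ad0 => /(_ j).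
  by rewrite mxE [in RHS]mxE => /normr0P/eqP ->; rewrite mxE.
have kM : \rank (kermx G) = 1%N.
  apply/eqP; rewrite eqn_leq lt0n mxrank_eq0 andbC; apply/andP; split.
    by apply/rowV0Pn; exists w => //; apply/sub_kermxP.
  rewrite (leq_trans (mxrankS (_ : _ <= u)%MS)) ?rank_leq_row //.
  by apply/row_subP => i; apply: M0; apply/sub_kermxP/row_sub.
have Mker (v : 'cV[R]_n) : v^T *m G = 0 -> M *m v = 0.
  move=> vG; apply/colP => i; have := mul_scaled_mx v i; rewrite vG mxE.
  by move/esym/eqP; rewrite mulf_eq0 gt_eqF //= => /eqP ->; rewrite mxE.
split.
- have -> : \rank M = \rank G.
    rewrite scaled_mxE -[LHS]mxrank_tr -[RHS]mxrank_tr trmx_mul.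
    by rewrite mxrankMfree // row_free_unit unitmx_tr diag_eps_unit.
  by move: kM; rewrite mxrank_ker; move: (rank_leq_row G); lia.
- exists u^T; split; last by apply: Mker; rewrite trmxK.
  by move=> i; rewrite mxE.
(* Pairing with [u] gives a vanishing sum of nonnegative terms [(v^T *m G) 0 j * u 0 j] with
   [u 0 j > 0]. *)
- move=> v Mv; apply: Mker.
  have vG j : 0 <= (v^T *m G) 0 j by rewrite mul_scaled_mx mulr_ge0 // ltW.
  have : bform G v^T u = 0 by rewrite bformC // (bform_ker _ uG).
  rewrite bformEr => /psumr_eq0P vGu; apply/rowP => j; rewrite [RHS]mxE.
  have /eqP := vGu (fun j _ => mulr_ge0 (vG j) (ltW (u_gt0 j))) j isT.
  by rewrite mulf_eq0 [u _ _ == 0]gt_eqF // orbF => /eqP.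
Qed.

End Scaled.

Lemma psd_finite_or_affine n (A : 'M[int]_n) (eps : 'I_n -> R) :
  (forall i, 0 < eps i) -> gen_cartan_matrix A ->
  (scaled_mx eps A)^T = scaled_mx eps A -> indecomposable A ->
  psd (scaled_mx eps A) -> finite_type R A \/ affine_type R A.
Proof.
move=> e0 Ag As Ai Ap; have [Gu|Gu] := boolP (scaled_mx eps A \in unitmx).
  by left; apply: (psd_unit_finite e0 Ag As Ai Ap Gu).
by right; apply: (psd_singular_affine e0 Ag As Ai Ap Gu).
Qed.

Lemma finite_or_affine_psd n (A : 'M[int]_n) (eps : 'I_n -> R) :
  (forall i, 0 < eps i) -> gen_cartan_matrix A ->
  (scaled_mx eps A)^T = scaled_mx eps A ->
  finite_type R A \/ affine_type R A -> psd (scaled_mx eps A).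
Proof.
move=> e0 Ag As Afa.
have [u [u0 uA]] : exists u : 'cV[R]_n,
    pos_vec u /\ nneg_vec (map_mx intr A *m u).
  case: Afa => [[_ [u [u0 uA]] _]|[_ [u [u0 uA]] _]]; exists u; split=> // i.
    exact/ltW/uA.
  by rewrite uA mxE.
apply: (@superharmonic_psd _ _ _ u^T) => // [|i|i].
- exact: scaled_offdiag.
- by rewrite mxE.
- by rewrite mul_scaled_mx // mulr_ge0 // ltW.
Qed.

(** * Hyperbolic type and coordinate subspaces *)

Lemma gcm_principal n (A : 'M[int]_n) (S : {set 'I_n}) :
  gen_cartan_matrix A -> gen_cartan_matrix (principal_submx A S).
Proof.
case=> A2 An A0; split=> [i|i j ij|i j]; rewrite !mxE //.
- by apply: An; rewrite (inj_eq enum_val_inj).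
- exact: A0.
Qed.

(** Induction on the size of [S], because the hyperbolic condition speaks only of indecomposable
    submatrices: a decomposable [S] splits into two smaller parts with no nonzero entries of [A]
    between them. *)
Lemma hyperbolic_sub_psd n (A : 'M[int]_n) (eps : 'I_n -> R) :
  (forall i, 0 < eps i) -> gen_cartan_matrix A ->
  (scaled_mx eps A)^T = scaled_mx eps A -> hyperbolic_type R A ->
  forall (S : {set 'I_n}) (x : 'I_n -> R), S \proper [set: 'I_n]%SET ->
  0 <= \sum_(i in S) \sum_(j in S) scaled_mx eps A i j * x i * x j.
Proof.
move=> e0 Ag As [_ _ Ah] S x.
set G := scaled_mx eps A.
have [m] := ubnP #|S|; elim: m S => // m IH S; rewrite ltnS => Sm Sp.
have [Si|] := pselect (indecomposable (principal_submx A S)).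
  pose ev := @enum_val _ (mem S).
  pose GS := scaled_mx (eps \o ev) (principal_submx A S).
  have GSE a b : GS a b = G (ev a) (ev b) by rewrite !mxE.
  have GSp : psd GS.
    apply: finite_or_affine_psd => [i||| //]; first exact: e0.
    - exact: gcm_principal.
    - by apply/matrixP => a b; rewrite mxE !GSE /G -[in LHS]As mxE.
    - exact: Ah.
  have := GSp (\row_a x (ev a)).
  congr (_ <= _); rewrite bformE [RHS]big_enum_val /=.
  apply: eq_bigr => a _; rewrite [RHS]big_enum_val /=.
  by apply: eq_bigr => b _; rewrite GSE !mxE.
move=> /existsNP[T0 /not_implyP[T0n /not_implyP[T0f T0s]]].
pose T := (@enum_val _ (mem S) @: T0)%SET.
have TS : T \subset S by apply/fintype.subsetP => _ /imsetP[a _ ->]; exact: enum_valP.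
have Tcard : #|T| = #|T0| by rewrite card_imset //; exact: enum_val_inj.
have T0c : (0 < #|T0| < #|S|)%N.
  rewrite card_gt0 T0n /= -[X in (_ < X)%N]card_ord -cardsT.
  by apply: proper_card; rewrite properT.
have split0 i j : i \in T -> j \in S :\: T -> G i j = 0.
  move=> /imsetP[a aT ->]; rewrite inE => /andP[jT jS].
  move: jT; rewrite -(enum_rankK_in jS jS).
  set b := enum_rank_in jS j => bT.
  have bT0 : b \notin T0 by apply: contra bT => bT; apply/imsetP; exists b.
  apply/eqP; rewrite mxE mulf_eq0 intr_eq0 gt_eqF //=.
  apply/negPn/negP => ab; apply: T0s; exists a, b; split=> //.
  by rewrite /principal_submx !mxE ab.
have split0' i j : i \in T -> j \in S :\: T -> G j i = 0.
  by move=> iT jT; rewrite /G -As mxE; apply: split0.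
have sumS (f : 'I_n -> R) :
    \sum_(i in S) f i = \sum_(i in T) f i + \sum_(i in S :\: T) f i.
  by rewrite (big_setID T) /=; congr (_ + _); rewrite (finset.setIidPr TS).
(* Splitting both sums gives four blocks: the two mixed ones vanish, the other two fall under the
   induction hypothesis. *)
rewrite sumS.
under eq_bigr => i _ do rewrite sumS.
under [X in _ + X]eq_bigr => i _ do rewrite sumS.
rewrite !big_split /=.
rewrite [X in _ + X + _]big1 => [|i iT]; last first.
  by rewrite big1 // => j jT; rewrite split0 // !mul0r.
rewrite [X in _ + (X + _)]big1 => [|i iT]; last first.
  by rewrite big1 // => j jT; rewrite split0' // !mul0r.
rewrite addr0 add0r addr_ge0 // IH //.
- by rewrite Tcard; move: T0c Sm; lia.
- exact: sub_proper_trans Sp.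
- by move: (cardsID T S); rewrite (finset.setIidPr TS) Tcard; move: T0c Sm; lia.
- exact: sub_proper_trans (subsetDl _ _) Sp.
Qed.

Lemma hyperbolic_hyperplane_psd n (A : 'M[int]_n) (eps : 'I_n -> R) :
  (forall i, 0 < eps i) -> gen_cartan_matrix A ->
  (scaled_mx eps A)^T = scaled_mx eps A -> hyperbolic_type R A ->
  forall i (x : 'rV[R]_n), x 0 i = 0 -> 0 <= bform (scaled_mx eps A) x x.
Proof.
move=> e0 Ag As Ah i x xi.
have := @hyperbolic_sub_psd _ _ _ e0 Ag As Ah [set~ i]%SET (x 0) _.
have -> : [set~ i]%SET \proper [set: 'I_n]%SET.
  by rewrite properT; apply/eqP => /setP/(_ i); rewrite !inE eqxx.
move/(_ isT); rewrite bformE.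
have sumC (f : 'I_n -> R) : f i = 0 -> \sum_k f k = \sum_(k in [set~ i]%SET) f k.
  move=> fi; rewrite (bigD1 i) //= fi add0r.
  by apply: eq_bigl => k; rewrite !inE.
congr (_ <= _); rewrite [RHS]sumC; last first.
  by apply: big1 => j _; rewrite xi mulr0 mul0r.
by apply: eq_bigr => j _; rewrite [RHS]sumC // xi mulr0.
Qed.

Lemma hyperbolic_indefinite n (A : 'M[int]_n) (eps : 'I_n -> R) :
  (forall i, 0 < eps i) -> gen_cartan_matrix A ->
  (scaled_mx eps A)^T = scaled_mx eps A -> indecomposable A ->
  hyperbolic_type R A -> exists x, bform (scaled_mx eps A) x x < 0.
Proof.
move=> e0 Ag As Ai [nf na _]; apply: contrapT => /forallNP nx.
have [//|//|//] := psd_finite_or_affine e0 Ag As Ai.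
by move=> x; rewrite leNgt; apply/negP.
Qed.

End VinbergTypes.

(** * Lorentzian forms *)

Section Lorentz.
Variable R : realType.

Lemma bform_mulmx m n (G : 'M[R]_n) (W : 'M[R]_(m, n)) (x y : 'rV[R]_m) :
  bform G (x *m W) (y *m W) = bform (W *m G *m W^T) x y.
Proof. by rewrite /bform trmx_mul !mulmxA. Qed.

Lemma block_diag_unit m n (P : 'M[R]_m) (Q : 'M[R]_n) :
  P \in unitmx -> Q \in unitmx -> block_mx P 0 0 Q \in unitmx.
Proof. by rewrite !unitmxE det_ublock unitrM => -> ->. Qed.

Lemma congruence_sym n (G P : 'M[R]_n) : G^T = G -> (P *m G *m P^T)^T = P *m G *m P^T.
Proof. by move=> Gs; rewrite !trmx_mul trmxK Gs mulmxA. Qed.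

(** One step of symmetric Gaussian elimination: the first basis vector is normalized and the others
    are made orthogonal to it, which leaves the Schur complement as [S]. *)
Lemma pd_schur n (G : 'M[R]_(1 + n)) : G^T = G ->
  (forall x, x != 0 -> 0 < bform G x x) ->
  exists P S, P \in unitmx /\ P *m G *m P^T = block_mx 1%:M 0 0 S.
Proof.
move=> Gs Gp; pose a := G (lshift n 0) (lshift n 0).
have a0 : 0 < a.
  have e0 : delta_mx 0 (lshift n 0) != 0 :> 'rV[R]_(1 + n).
    apply/eqP => /rowP/(_ (lshift n 0)); rewrite !mxE !eqxx => /eqP.
    by rewrite oner_eq0.
  have := Gp _ e0; congr (_ < _); rewrite /bform -rowE trmx_delta -colE.
  by rewrite !mxE.
pose s := Num.sqrt a; have s0 : s != 0 by rewrite gt_eqF // sqrtr_gt0.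
have sa : s^-1 * a * s^-1 = 1.
  by rewrite -[a]sqr_sqrtr ?ltW // -/s; field.
pose b := ursubmx G; pose d := drsubmx G.
have GE : G = block_mx a%:M b b^T d.
  rewrite -[G in LHS]submxK; congr block_mx.
    by rewrite [LHS]mx11_scalar !mxE.
  by rewrite /b trmx_ursub Gs.
exists (block_mx (s^-1)%:M 0 (- (a^-1) *: b^T) 1%:M), (d - a^-1 *: (b^T *m b)).
split.
  rewrite unitmxE det_lblock det_scalar1 det1 mulr1 unitfE invr_eq0.
  by [].
rewrite [in LHS]GE tr_block_mx !tr_scalar_mx !linear0 !linearZ /= trmxK.
rewrite !mulmx_block !mul0mx !mulmx0 !mul1mx !mulmx1 ?addr0 ?add0r.
have bb0 : - a^-1 *: b^T *m a%:M + b^T = 0.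
  by rewrite mul_mx_scalar scalerA mulrN mulfV ?gt_eqF // scaleN1r addNr.
congr block_mx.
- by rewrite -!scalar_mxM sa.
- rewrite -scalar_mxM !mul_scalar_mx scalerA -scalerDl mulrN mulfK ?gt_eqF //.
  by rewrite addNr scale0r.
- by rewrite bb0 mul0mx.
- by rewrite bb0 mul0mx add0r addrC -scalemxAl scaleNr scalerN.
Qed.

(** Induction through [pd_schur]: the Schur complement is again positive definite, being the form
    [G] on the vectors [row_mx 0 y *m P]. *)
Lemma cholesky n (G : 'M[R]_n) : G^T = G ->
  (forall x, x != 0 -> 0 < bform G x x) ->
  exists2 P, P \in unitmx & P *m G *m P^T = 1%:M.
Proof.
elim: n G => [|n IH] G; first by exists 1%:M; rewrite ?unitmx1 //; apply/matrixP => -[].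
move: G; rewrite -[n.+1]/(1 + n)%N => G Gs Gp.
have [P [S [Pu PG]]] := pd_schur Gs Gp.
have Ss : S^T = S.
  have := congruence_sym P Gs; rewrite PG tr_block_mx.
  by move/eq_block_mx => [].
have Sp y : y != 0 -> 0 < bform S y y.
  move=> y0; have -> : bform S y y = bform G (row_mx 0 y *m P) (row_mx 0 y *m P).
    rewrite bform_mulmx PG /bform mul_row_block tr_row_mx.
    by rewrite !mul0mx mulmx0 !add0r mul_row_col mul0mx add0r.
  apply: Gp; apply: contra_neq y0 => yP.
  have := mulmxK Pu (row_mx 0 y); rewrite yP mul0mx => /esym/eqP.
  by rewrite row_mx_eq0 => /andP[_ /eqP].
have [Q Qu QS] := IH S Ss Sp.
exists (block_mx (1%:M : 'M_1) 0 0 Q *m P).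
  by rewrite unitmx_mul Pu andbT; apply: (@block_diag_unit 1 n); rewrite ?unitmx1.
rewrite trmx_mul -!mulmxA (mulmxA G) (mulmxA P) (mulmxA P) PG.
rewrite tr_block_mx !trmx0 trmx1 !mulmx_block !mul0mx !mulmx0 !mul1mx ?mulmx1.
rewrite ?addr0 ?add0r ?mulmx0 ?mul0mx ?mulmxA QS.
by rewrite -scalar_mx_block.
Qed.

(** * Forms with a negative vector, nonnegative on coordinate hyperplanes *)

Section LorentzForm.
Variables (p : nat) (G : 'M[R]_(p + 1)).
Hypothesis G_sym : G^T = G.
Hypothesis G_hyperplane : forall i (x : 'rV[R]_(p + 1)),
  x 0 i = 0 -> 0 <= bform G x x.
Variable x : 'rV[R]_(p + 1).
Hypothesis x_neg : bform G x x < 0.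

Lemma lorentz_kernel (w : 'rV[R]_(p + 1)) : w *m G = 0 -> w = 0.
Proof.
move=> wG; apply/rowP => i; rewrite [RHS]mxE; apply/eqP/negPn/negP => wi.
pose z := x - (x 0 i / w 0 i) *: w.
have := @G_hyperplane i z; rewrite !mxE divfK // subrr => /(_ erefl).
rewrite /z -scaleNr !(bformDl, bformDr, bformZl, bformZr).
by rewrite (bformC x) // !(bform_ker _ wG) !mulr0 !addr0 leNgt x_neg.
Qed.

Lemma lorentz_orthogonal (w : 'rV[R]_(p + 1)) : bform G w x = 0 -> 0 <= bform G w w.
Proof.
move=> wx; rewrite leNgt; apply/negP => w_neg; pose i := rshift p (0 : 'I_1).
(* Coordinate [i] cancels, and by orthogonality the form takes here the value [w 0 i ^+ 2 * bform G
   x x + x 0 i ^+ 2 * bform G w w], negative once [x 0 i] is nonzero. *)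
have := @G_hyperplane i (w 0 i *: x - x 0 i *: w).
rewrite !mxE mulrC subrr => /(_ erefl).
rewrite -scaleNr !(bformDl, bformDr, bformZl, bformZr) (bformC x) // wx.
have xi : x 0 i != 0.
  by apply: contraTneq x_neg => /G_hyperplane; rewrite leNgt.
have : 0 < x 0 i ^+ 2 by rewrite exprn_even_gt0.
have := sqr_ge0 (w 0 i); move: x_neg w_neg => *; nra.
Qed.

(** The basis consists of an orthonormal basis of the complement of [x], of dimension [p], followed
    by [x] rescaled to square length [-1]. *)
Lemma lorentz_orthonormal_basis : exists2 P, P \in unitmx &
  P *m G *m P^T = block_mx (1%:M : 'M_p) 0 0 (- 1)%:M.
Proof.
have [W Wf Wx] : exists2 W : 'M[R]_(p, p + 1), row_free W & W *m G *m x^T = 0.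
  have rk : \rank (kermx (G *m x^T)) = p.
    rewrite mxrank_ker; suff -> : \rank (G *m x^T) = 1%N by rewrite addnK.
    apply/eqP; rewrite eqn_leq rank_leq_col lt0n mxrank_eq0.
    by apply: contraTneq x_neg; rewrite /bform -mulmxA => ->; rewrite mulmx0 mxE ltxx.
  have := row_base_free (kermx (G *m x^T)).
  have : row_base (kermx (G *m x^T)) *m (G *m x^T) = 0.
    by apply/sub_kermxP; rewrite eq_row_base.
  move: (row_base _); rewrite rk => W WG Wf.
  by exists W; rewrite // -mulmxA.
have xW : x *m G *m W^T = 0.
  by apply: trmx_inj; rewrite !trmx_mul trmxK G_sym mulmxA Wx trmx0.
have qE : x *m G *m x^T = (bform G x x)%:M by rewrite [LHS]mx11_scalar.
have Mu : col_mx W x \in unitmx.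
  rewrite -row_free_unit; apply: inj_row_free => v.
  rewrite -[v]hsubmxK mul_row_col => xv.
  have := xv => /(congr1 (fun u => u *m (G *m x^T))).
  rewrite mulmxDl -mulmxA [W *m _]mulmxA Wx mulmx0 add0r mul0mx.
  rewrite -mulmxA [x *m _]mulmxA qE mul_mx_scalar => /eqP.
  rewrite scaler_eq0 lt_eqF //= => /eqP v2.
  have v1 : lsubmx v = 0.
    by apply: (row_free_inj Wf); rewrite mul0mx -[RHS]xv v2 mul0mx addr0.
  by rewrite v1 v2 row_mx0.
have Gps : (W *m G *m W^T)^T = W *m G *m W^T.
  by rewrite !trmx_mul trmxK G_sym mulmxA.
(* On the complement the form is nonnegative; an isotropic [w] there is orthogonal to the rows of
   [W] and to [x], hence to everything, so [lorentz_kernel] applies. *)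
have Gp y : y != 0 -> 0 < bform (W *m G *m W^T) y y.
  move=> y0; set w := y *m W.
  have wx : w *m G *m x^T = 0 by rewrite -!mulmxA (mulmxA W) Wx mulmx0.
  rewrite lt_def -bform_mulmx lorentz_orthogonal ?andbT; last first.
    by rewrite /bform wx mxE.
  apply: contra_neq y0; rewrite bform_mulmx => /(psd_isotropic Gps) yG.
  have wW : w *m G *m W^T = 0.
    rewrite -!mulmxA !(mulmxA W); apply: yG => z; rewrite -bform_mulmx.
    apply: lorentz_orthogonal; rewrite /bform -!mulmxA (mulmxA W) Wx mulmx0.
    by rewrite mxE.
  have wG : w *m G = 0.
    have : w *m G *m (col_mx W x)^T = 0 by rewrite tr_col_mx mul_mx_row wW wx row_mx0.
    by move/(canRL (mulmxK (etrans (unitmx_tr _) Mu))); rewrite mul0mx.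
  apply: (row_free_inj Wf); rewrite mul0mx; exact: lorentz_kernel.
have [Q Qu QG] := cholesky Gps Gp.
pose s := Num.sqrt (- bform G x x).
have s0 : s != 0 by rewrite gt_eqF // sqrtr_gt0 oppr_gt0.
have sE : bform G x x = - (s ^+ 2) by rewrite sqr_sqrtr ?opprK // oppr_ge0 ltW.
exists (block_mx Q 0 0 (s^-1)%:M *m col_mx W x).
  rewrite unitmx_mul Mu block_diag_unit // unitmxE det_scalar1 unitfE.
  by rewrite invr_eq0.
have MG : col_mx W x *m G *m (col_mx W x)^T =
    block_mx (W *m G *m W^T) 0 0 (bform G x x)%:M.
  by rewrite tr_col_mx mul_col_mx mul_col_row Wx xW qE.
rewrite trmx_mul -!mulmxA (mulmxA G) (mulmxA (col_mx W x)) (mulmxA (col_mx W x)) MG.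
rewrite tr_block_mx !trmx0 tr_scalar_mx !mulmx_block !mul0mx !mulmx0 ?addr0 ?add0r.
rewrite ?mulmx0 ?mul0mx mulmxA QG -!scalar_mxM; congr block_mx.
by rewrite sE; congr (_%:M); field.
Qed.
End LorentzForm.

End Lorentz.

(** * Real forms of the Cartan subalgebra *)

Section RealSpans.
Variables (R : realType) (g : lieAlgType R[i]).
Local Notation "r %:C" := (real_complex R r).

(** Coefficients form a row vector, so that a change of basis is right multiplication by a
    matrix. *)
Definition rcomb n (v : 'I_n -> g) (c : 'rV[R]_n) : g :=
  \sum_i (c 0 i)%:C *: v i.

Lemma rcomb_linear n (v : 'I_n -> g) (a : R) x y :
  rcomb v (a *: x + y) = a%:C *: rcomb v x + rcomb v y.
Proof.
rewrite /rcomb scaler_sumr -big_split /=; apply: eq_bigr => i _.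
by rewrite !mxE rmorphD rmorphM scalerDl scalerA.
Qed.

Lemma real_basisP n (v : 'I_n -> g) V :
  real_basis v V <-> (forall c, rcomb v c = 0 -> c = 0) /\ V = range (rcomb v).
Proof.
have rcE (c : 'I_n -> R) : \sum_i (c i)%:C *: v i = rcomb v (\row_i c i).
  by apply: eq_bigr => i _; rewrite mxE.
have -> : range (rcomb v) =
    [set \sum_i (c i)%:C *: v i | c in [set: 'I_n -> R]].
  apply/seteqP; split=> _ [c _ <-]; first by exists (c 0).
  by rewrite rcE; exists (\row_i c i).
split=> -[v0 ->]; split=> //.
  by move=> c /v0 c0; apply/rowP => i; rewrite c0 mxE.
by move=> c; rewrite rcE => /v0/rowP c0 i; have := c0 i; rewrite !mxE.
Qed.

Lemma rcomb_mulmx n (v : 'I_n -> g) (P : 'M[R]_n) c :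
  rcomb (fun i => rcomb v (row i P)) c = rcomb v (c *m P).
Proof.
rewrite /rcomb; under eq_bigr => i _ do rewrite scaler_sumr.
rewrite exchange_big /=; apply: eq_bigr => j _.
rewrite mxE rmorph_sum scaler_suml; apply: eq_bigr => i _.
by rewrite scalerA rmorphM !mxE.
Qed.

Lemma real_basis_mulmx n (v : 'I_n -> g) V (P : 'M[R]_n) : P \in unitmx ->
  real_basis v V -> real_basis (fun i => rcomb v (row i P)) V.
Proof.
move=> Pu /real_basisP[v0 ->]; apply/real_basisP; split.
  move=> c; rewrite rcomb_mulmx => /v0 cP.
  by rewrite -(mulmxK Pu c) cP mul0mx.
apply/seteqP; split=> _ [c _ <-]; last by rewrite rcomb_mulmx; exists (c *m P).
by exists (c *m invmx P); rewrite // rcomb_mulmx mulmxKV.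
Qed.

Lemma real_basis_reindex m n (s : 'I_m -> 'I_n) (s' : 'I_n -> 'I_m)
    (v : 'I_n -> g) V : cancel s s' -> cancel s' s ->
  real_basis v V -> real_basis (v \o s) V.
Proof.
move=> sK s'K [v0 ->].
have cs (c : 'I_n -> R) :
    \sum_i (c i)%:C *: v i = \sum_i (c (s i))%:C *: v (s i).
  by rewrite (reindex s) //; exists s' => i _; rewrite ?sK ?s'K.
split=> [c c0 j|].
  rewrite -[j]sK; apply: (v0 (c \o s')); rewrite cs -[RHS]c0.
  by apply: eq_bigr => i _; rewrite /= sK.
apply/seteqP; split=> _ [c _ <-]; first by rewrite cs; exists (c \o s).
exists (c \o s') => //; rewrite cs; apply: eq_bigr => i _.
by rewrite /= sK.
Qed.

(** The scalar [a] is complex, so the real span may move; [a = 'i] leads from [split_cartan] to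
    [compact_cartan]. *)
Lemma real_basis_scale n (a : R[i]) (v : 'I_n -> g) V : a != 0 ->
  real_basis v V -> real_basis (fun i => a *: v i) [set a *: x | x in V].
Proof.
move=> a0 /real_basisP[v0 ->].
have ac c : rcomb (fun i => a *: v i) c = a *: rcomb v c.
  rewrite /rcomb scaler_sumr; apply: eq_bigr => i _.
  by rewrite !scalerA mulrC.
apply/real_basisP; split=> [c|].
  by rewrite ac => /eqP; rewrite scaler_eq0 (negbTE a0) /= => /eqP/v0.
apply/seteqP; split=> [_ [_ [c _ <-] <-]|_ [c _ <-]].
  by exists c.
by rewrite ac; exists (rcomb v c) => //; exists c.
Qed.

(** The Gram matrix of the standard basis of $\mathbb R^{p,q}$. *)
Definition Rpq_mx p q : 'M[R]_(p + q) := block_mx 1%:M 0 0 (- 1)%:M.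

Lemma bform_Rpq p q (x y : 'rV[R]_(p + q)) :
  bform (Rpq_mx p q) x y = pseudo_euclidean x y.
Proof.
rewrite /bform -[x in LHS]hsubmxK -[y in LHS]hsubmxK /Rpq_mx.
rewrite mul_row_block tr_row_mx mul_row_col !mulmx0 mulmx1 addr0 add0r.
rewrite mul_mx_scalar scaleN1r mulNmx !mxE; congr (_ - _).
  by apply: eq_bigr => i _; rewrite !mxE.
by apply: eq_bigr => i _; rewrite !mxE.
Qed.

Section Forms.
Variable B : {symmetric g}.

Lemma form_rcomb n (v : 'I_n -> g) (G : 'M[R]_n) (x y : 'rV[R]_n) :
  (forall i j, B (v i) (v j) = (G i j)%:C) ->
  B (rcomb v x) (rcomb v y) = (bform G x y)%:C.
Proof.
move=> vG; rewrite /rcomb linear_sumlz bformE rmorph_sum; apply: eq_bigr => i _.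
rewrite linear_sumr rmorph_sum; apply: eq_bigr => j _.
by rewrite linearZl_LR linearZr_LR /= vG !rmorphM /= mulrA mulrC mulrA.
Qed.

(** One basis serves both conclusions: its coordinate map is the isometry and its vectors witness
    the signature. *)
Lemma isometric_and_signature p q (v : 'I_(p + q) -> g) V : real_basis v V ->
  (forall i j, B (v i) (v j) = (Rpq_mx p q i j)%:C) ->
  isometric_to_Rpq B V p q /\ has_signature B V p q.
Proof.
move=> vV vB; split.
  move/real_basisP: (vV) => [v0 VE]; exists (rcomb v); split=> //.
  - exact: rcomb_linear.
  - move=> x y xy; apply/eqP; rewrite -subr_eq0; apply/eqP/v0.
    by rewrite addrC -scaleN1r rcomb_linear xy rmorphN1 scaleN1r addNr.
  - by move=> x y; rewrite (form_rcomb _ _ vB) bform_Rpq.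
exists v; split=> // [i j|i|j].
- rewrite vB; case: (split_ordP i) => a ->; case: (split_ordP j) => b ->;
    by rewrite ?eq_shift ?block_mxEul ?block_mxEur ?block_mxEdl ?block_mxEdr
      !mxE // => /negbTE ->.
- by rewrite vB block_mxEul mxE eqxx ltr01.
- by rewrite vB block_mxEdr mxE eqxx rmorphN1 oppr_lt0 ltr01.
Qed.

End Forms.

(** Multiplication by ['i] negates the form and so puts the negative directions first; exchanging
    the blocks restores the order that [has_signature] expects. *)
Definition swap_ord m n (i : 'I_(m + n)) : 'I_(n + m) :=
  match split i with inl a => rshift n a | inr b => lshift m b end.

Lemma swap_ord_lshift m n (a : 'I_m) : swap_ord (lshift n a) = rshift n a.
Proof. by rewrite /swap_ord (unsplitK (inl a)). Qed.

Lemma swap_ord_rshift m n (b : 'I_n) : swap_ord (rshift m b) = lshift m b.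
Proof. by rewrite /swap_ord (unsplitK (inr b)). Qed.

Lemma swap_ordK m n : cancel (@swap_ord m n) (@swap_ord n m).
Proof.
move=> i; case: (split_ordP i) => a ->.
  by rewrite swap_ord_lshift swap_ord_rshift.
by rewrite swap_ord_rshift swap_ord_lshift.
Qed.

Lemma Rpq_swap m n i j :
  Rpq_mx n m (swap_ord i) (swap_ord j) = - Rpq_mx m n i j.
Proof.
case: (split_ordP i) => a ->; case: (split_ordP j) => b ->;
  rewrite ?swap_ord_lshift ?swap_ord_rshift /Rpq_mx;
  rewrite ?block_mxEul ?block_mxEur ?block_mxEdl ?block_mxEdr !mxE ?oppr0 //.
  by rewrite mulNrn.
by rewrite mulNrn opprK.
Qed.

End RealSpans.

(** * Bracket identities and sign changes of Chevalley generators *)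

Section LieOpposite.
Variables (K : fieldType) (L : lieAlgType K).
Implicit Types x y : L.

Lemma lieDl x y z : lie (x + y) z = lie x z + lie y z.
Proof. by have := lie_linearl z 1 x y; rewrite !scale1r. Qed.

Lemma lieDr x y z : lie z (x + y) = lie z x + lie z y.
Proof. by have := lie_linearr z 1 x y; rewrite !scale1r. Qed.

Lemma lie0l x : lie 0 x = 0.
Proof. by apply: (addrI (lie 0 x)); rewrite -lieDl !addr0. Qed.

Lemma lie0r x : lie x 0 = 0.
Proof. by apply: (addrI (lie x 0)); rewrite -lieDr !addr0. Qed.

Lemma lieZr a x y : lie x (a *: y) = a *: lie x y.
Proof. by have := lie_linearr x a y 0; rewrite lie0r !addr0. Qed.

Lemma lieNl x y : lie (- x) y = - lie x y.
Proof. by apply: (addrI (lie x y)); rewrite -lieDl !subrr lie0l. Qed.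

Lemma lieNr x y : lie x (- y) = - lie x y.
Proof. by apply: (addrI (lie x y)); rewrite -lieDr !subrr lie0r. Qed.

Lemma lie_anti x y : lie x y = - lie y x.
Proof.
apply/eqP; rewrite -addr_eq0; have := liexx (x + y).
by rewrite lieDl !lieDr !liexx add0r addr0 => ->.
Qed.

Lemma iter_lieN k x y :
  iter k (lie (- x)) (- y) = (- 1) ^+ k.+1 *: iter k (lie x) y.
Proof.
elim: k => [|k IH] /=; first by rewrite expr1 scaleN1r.
by rewrite IH lieZr lieNl [in RHS]exprS mulN1r scaleNr scalerN.
Qed.

(** Fed to the universal property in [kac_moody_algebra], these generators yield the linear
    Chevalley involution. *)
Lemma chevalley_serre_opp n (A : 'M[int]_n) (e f h : 'I_n -> L) :
  chevalley_serre A e f h ->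
  chevalley_serre A (fun i => - f i) (fun i => - e i) (fun i => - h i).
Proof.
case=> hh he hf ef ee ff; split=> [i j|i j|i j|i j|i j ij|i j ij].
- by rewrite lieNl lieNr hh !oppr0.
- by rewrite lieNl lieNr hf scalerN opprK.
- by rewrite lieNl lieNr he scalerN !opprK.
- rewrite lieNl lieNr opprK lie_anti ef eq_sym.
  by case: eqVneq => [->|_] //; rewrite oppr0.
- by rewrite iter_lieN ff // scaler0.
- by rewrite iter_lieN ee // scaler0.
Qed.

End LieOpposite.

(** * Split and compact Cartan subalgebras in coordinates *)

Section CartanForms.
Variables (R : realType) (g : lieAlgType R[i]) (l : nat) (A : 'M[int]_l).
Variables (e f h : 'I_l -> g) (omega : g -> g).
Hypothesis g_km : kac_moody_algebra A e f h.
Hypothesis omega_ci : compact_involution e f h omega.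
Hypothesis h_free : forall c : 'I_l -> R[i],
  \sum_i c i *: h i = 0 -> forall i, c i = 0.
Local Notation "r %:C" := (real_complex R r).

Lemma compact_involutionD x y : omega (x + y) = omega x + omega y.
Proof.
by have := ci_conj_linear omega_ci 1 x y; rewrite /= rmorph1 !scale1r.
Qed.

Lemma compact_involution0 : omega 0 = 0.
Proof. by apply: (addrI (omega 0)); rewrite -compact_involutionD !addr0. Qed.

Lemma compact_involutionZ a x : omega (a *: x) = Num.conj a *: omega x.
Proof.
have := ci_conj_linear omega_ci a x 0.
by rewrite /= compact_involution0 !addr0.
Qed.

Lemma compact_involutionN x : omega (- x) = - omega x.
Proof. by rewrite -scaleN1r compact_involutionZ rmorphN1 scaleN1r. Qed.

Lemma conj_real (r : R) : Num.conj r%:C = r%:C.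
Proof. exact: conjc_real. Qed.

Lemma compact_involution_cartan (c : 'I_l -> R[i]) :
  omega (\sum_i c i *: h i) = - \sum_i Num.conj (c i) *: h i.
Proof.
rewrite (big_morph omega compact_involutionD compact_involution0) -sumrN.
apply: eq_bigr => i _.
by rewrite compact_involutionZ (ci_h omega_ci) scalerN.
Qed.

Lemma cartan_inj (c d : 'I_l -> R[i]) :
  \sum_i c i *: h i = \sum_i d i *: h i -> c =1 d.
Proof.
move=> cd i; apply/eqP; rewrite -subr_eq0; apply/eqP.
apply: (h_free (c := fun i => c i - d i)).
under eq_bigr => j _ do rewrite scalerBl.
by rewrite big_split /= sumrN cd subrr.
Qed.

(* Composing [omega] with the linear Chevalley involution gives the
   conjugation of [g] with respect to the split form. *)
Lemma split_conjugation : exists sigma : g -> g,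
  (forall x, split_form e f h x -> sigma x = x) /\
  forall c : 'I_l -> R[i],
    sigma (\sum_i c i *: h i) = \sum_i Num.conj (c i) *: h i.
Proof.
case: g_km => cs /(_ g _ _ _ (chevalley_serre_opp cs))[phi [phi_lie phi_gen _]].
exists (omega \o phi); split=> [x|c] /=; last first.
  suff -> : phi (\sum_i c i *: h i) = - \sum_i c i *: h i.
    by rewrite compact_involutionN compact_involution_cartan opprK.
  rewrite linear_sum -sumrN; apply: eq_bigr => i _; rewrite linearZ_LR /=.
  by have [_ _ ->] := phi_gen i; rewrite scalerN.
(* The fixed points of [omega \o phi] form a real Lie subalgebra containing the generators, and
   [split_form] is the smallest such. *)
move=> xs; apply: (xs [set y | omega (phi y) = y]); split.
  split=> /= [|y z yE zE|r y yE|y z yE zE].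
  - by rewrite linear0 compact_involution0.
  - by rewrite linearD compact_involutionD yE zE.
  - by rewrite linearZ_LR compact_involutionZ yE conj_real.
  - by rewrite phi_lie (ci_lie omega_ci) yE zE.
move=> _ [[|]|] [i _ <-] /=; have [pe pf ph] := phi_gen i;
  rewrite ?pe ?pf ?ph compact_involutionN.
- by rewrite (ci_f omega_ci) opprK.
- by rewrite (ci_e omega_ci) opprK.
- by rewrite (ci_h omega_ci) opprK.
Qed.

Lemma real_basis_split_cartan : real_basis h (split_cartan e f h).
Proof.
split.
  by move=> c c0 i; have [] := h_free (c := fun i => (c i)%:C) c0 i.
apply/seteqP; split=> [x [[c _ <-] cs]|_ [c _ <-]].
  have [sigma [sE sh]] := split_conjugation.
  have := sE _ cs; rewrite sh => /cartan_inj cr.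
  exists (fun i => complex.Re (c i)) => //; apply: eq_bigr => i _.
  congr (_ *: _); apply: RRe_real; apply/Num.Theory.CrealP; exact: cr.
split; first by exists (fun i => (c i)%:C).
move=> S [[S0 SD SZ _] SG]; apply: (big_ind S) => // i _.
by apply: SZ; apply: SG; right; exists i.
Qed.

(** In the coordinates given by [h], [omega] negates and conjugates, so its fixed points are the
    combinations with purely imaginary coefficients. *)
Lemma compact_cartanE :
  compact_cartan h omega = [set 'i *: x | x in split_cartan e f h].
Proof.
have [_ ->] := real_basis_split_cartan.
apply/seteqP; split=> [x [[c _ <-]]|_ [_ [c _ <-] <-]].
  rewrite /compact_form /= compact_involution_cartan -sumrN.
  move=> cx; have cE : (fun i => - Num.conj (c i)) =1 c.
    by apply: cartan_inj; rewrite -cx; apply: eq_bigr => i _; rewrite scaleNr.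
  exists (\sum_i (complex.Im (c i))%:C *: h i).
    by exists (fun i => complex.Im (c i)).
  rewrite scaler_sumr; apply: eq_bigr => i _; rewrite scalerA; congr (_ *: _).
  have := cE i; case: (c i) => a b /= [aE _].
  have -> : a = 0 by lra.
  by rewrite [RHS]complexE /= rmorph0 add0r complexiE.
split.
  exists (fun i => 'i * (c i)%:C) => //; rewrite scaler_sumr.
  by apply: eq_bigr => i _; rewrite scalerA.
rewrite /compact_form /= scaler_sumr.
under eq_bigr => i _ do rewrite scalerA.
rewrite compact_involution_cartan -sumrN; apply: eq_bigr => i _.
by rewrite rmorphM /= conjCi conj_real mulNr scaleNr opprK.
Qed.

End CartanForms.

(** * The Gram matrix of the coroots *)

Section GramMatrix.
Variables (R : realType) (g : lieAlgType R[i]) (l : nat) (A : 'M[int]_l).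
Variables (e f h : 'I_l -> g) (B : {symmetric g}).
Hypothesis cs : chevalley_serre A e f h.
Hypothesis A_gcm : gen_cartan_matrix A.
Hypothesis B_inv : normalized_invariant_form h B.
Local Notation "r %:C" := (real_complex R r).

(** [scaled_mx] takes real weights while the form is complex valued; by [root_scaleE] the real part
    loses nothing. *)
Definition root_scale i : R := complex.Re (B (e i) (f i)).

Lemma form_coroots i j : B (h i) (h j) = B (e i) (f i) * (A i j)%:~R.
Proof.
have <- : lie (e i) (f i) = h i by rewrite (cs_ef cs) eqxx.
rewrite (nif_invariant B_inv) lie_anti (cs_hf cs) opprK.
by rewrite linearZr_LR /= mulrC.
Qed.

Lemma root_scaleE i : 0 < root_scale i /\ B (e i) (f i) = (root_scale i)%:C.
Proof.
have : 0 < B (e i) (f i).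
  have := nif_normalized B_inv i; rewrite form_coroots.
  by case: A_gcm => -> _ _; rewrite pmulr_lgt0 // ltr0n.
rewrite /root_scale ltcE /= => /andP[/eqP Bi Br]; split=> //.
by apply/eqP; rewrite eq_complex /= -Bi !eqxx.
Qed.

Lemma gram_coroots i j : B (h i) (h j) = (scaled_mx root_scale A i j)%:C.
Proof.
rewrite form_coroots mxE rmorphM rmorph_int.
by have [_ ->] := root_scaleE i.
Qed.

Lemma gram_sym : (scaled_mx root_scale A)^T = scaled_mx root_scale A.
Proof.
apply/matrixP => i j; rewrite [LHS]mxE; apply: (@complexI R).
by rewrite -!gram_coroots hermC expr0 mul1r.
Qed.

(** Pairing a vanishing combination with each [h j] puts its complex coefficient vector in the left
    kernel of the Gram matrix, which stays invertible over [R[i]]. *)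
Lemma coroots_free : scaled_mx root_scale A \in unitmx ->
  forall c : 'I_l -> R[i], \sum_i c i *: h i = 0 -> forall i, c i = 0.
Proof.
move=> Gu c c0.
pose GC := map_mx (real_complex R) (scaled_mx root_scale A).
have GCu : GC \in unitmx by rewrite map_unitmx.
have cG : (\row_i c i) *m GC = 0.
  apply/rowP => j; rewrite mxE [RHS]mxE -[RHS](linear0l B (h j)) -c0 linear_sumlz.
  apply: eq_bigr => i _.
  by rewrite linearZl_LR /= gram_coroots [(\row_k _) _ _]mxE [GC _ _]mxE.
move=> i; have := mulmxK GCu (\row_i c i); rewrite cG mul0mx => /rowP/(_ i).
by rewrite !mxE.
Qed.

End GramMatrix.

(** The rank is written [p + 1] so that vectors and matrices split into blocks of sizes [p] and
    1. *)
Lemma coroot_signature (R : realType) (p : nat) (A : 'M[int]_(p + 1))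
    (A_gcm : gen_cartan_matrix A) (A_indec : indecomposable A)
    (A_hyp : hyperbolic_type R A)
    (g : lieAlgType R[i]) (e f h : 'I_(p + 1) -> g)
    (g_km : kac_moody_algebra A e f h)
    (omega : g -> g) (omega_ci : compact_involution e f h omega)
    (B : {symmetric g}) (B_inv : normalized_invariant_form h B) :
  let hR := split_cartan e f h in
  let t := compact_cartan h omega in
  [/\ isometric_to_Rpq B hR p 1 /\ has_signature B hR p 1,
      t = [set 'i *: x | x in hR] &
      isometric_to_Rpq B t 1 p /\ has_signature B t 1 p].
Proof.
have cs := g_km.1; move=> hR t.
pose G := scaled_mx (root_scale e f B) A.
have eps0 i : 0 < root_scale e f B i by have [] := root_scaleE cs A_gcm B_inv i.
have Gs : G^T = G by apply: (gram_sym cs A_gcm B_inv).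
have [x xneg] := hyperbolic_indefinite eps0 A_gcm Gs A_indec A_hyp.
have Ghyp := hyperbolic_hyperplane_psd eps0 A_gcm Gs A_hyp.
have Gu : G \in unitmx.
  by rewrite -row_free_unit; apply: inj_row_free => v; apply: lorentz_kernel xneg v.
have h_free := coroots_free cs A_gcm B_inv Gu.
have tE : t = [set 'i *: x | x in hR] by exact: (compact_cartanE g_km omega_ci h_free).
have hRb : real_basis h hR by exact: (real_basis_split_cartan g_km omega_ci h_free).
have [P Pu PG] := lorentz_orthonormal_basis Gs Ghyp xneg.
pose v i := rcomb h (row i P).
have vB i j : B (v i) (v j) = (Rpq_mx R p 1 i j)%:C%C.
  rewrite (form_rcomb _ _ (gram_coroots cs A_gcm B_inv)) /Rpq_mx -PG.
  congr (_%:C)%C; rewrite bformEr -row_mul [RHS]mxE.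
  by apply: eq_bigr => k _; rewrite [row i _ _ _]mxE [row j _ _ _]mxE [P^T _ _]mxE.
have vb : real_basis v hR by apply: real_basis_mulmx.
split=> //; first exact: isometric_and_signature vb vB.
have i0 : 'i != 0 :> R[i] by rewrite neq0Ci.
(* The form changes sign when both arguments are multiplied by ['i], so the reordered vectors have
   Gram matrix [Rpq_mx R 1 p]. *)
rewrite tE; apply: (isometric_and_signature (v := fun i => 'i *: v (swap_ord i))).
  apply: (real_basis_scale (v := v \o @swap_ord 1 p)) => //.
  by apply: real_basis_reindex vb; apply: swap_ordK.
move=> i j; rewrite linearZl_LR linearZr_LR /= mulrA -expr2 sqrCi mulN1r vB.
by rewrite Rpq_swap rmorphN opprK.
Qed.

Theorem proposition3p1 (R : realType) (l : nat) (A : 'M[int]_l)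
    (A_gcm : gen_cartan_matrix A) (A_indec : indecomposable A)
    (A_sym : symmetrizable A) (A_hyp : hyperbolic_type R A)
    (g : lieAlgType R[i]) (e f h : 'I_l -> g)
    (g_km : kac_moody_algebra A e f h)
    (omega : g -> g) (omega_ci : compact_involution e f h omega)
    (B : {symmetric g}) (B_inv : normalized_invariant_form h B) :
  let hR := split_cartan e f h in
  let t := compact_cartan h omega in
  [/\ isometric_to_Rpq B hR l.-1 1 /\ has_signature B hR l.-1 1,
      t = [set 'i *: x | x in hR] &
      isometric_to_Rpq B t 1 l.-1 /\ has_signature B t 1 l.-1].
Proof.
have lE : l = (l.-1 + 1)%N.
  suff : (0 < l)%N by lia.
  (* Rank zero must be excluded, as [0.-1] is 0: the empty matrix has determinant 1 and meets the
     other conditions of finite type vacuously. *)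
  rewrite lt0n; apply/eqP => l0; subst l; case: A_hyp => nf _ _; apply: nf.
  split; first by rewrite det_mx00 oner_neq0.
  - by exists 0; split; case.
  - by move=> v _; left; case.
clear A_sym; move: (l.-1) lE => p lE; subst l.
exact: (coroot_signature A_gcm A_indec A_hyp g_km omega_ci B_inv).
Qed.
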